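(* Let $p,q\ge 1$ be integers with $pq>4$, and let $\mu_{p,q}:\mathbb{CP}^2\dashrightarrow\mathbb{CP}^2$ be the birational map given in affine coordinates by $$\mu_{p,q}=\mu^{(2)}_{p,q}\circ\mu^{(1)}_{p,q},\qquad \mu^{(1)}_{p,q}(x,y)=\left(\frac{1+y^q}{x},\,y\right),\qquad \mu^{(2)}_{p,q}(x,y)=\left(x,\,\frac{1+x^p}{y}\right).$$ Then $\mu_{p,q}$ does not preserve an invariant fibration. In particular, $\mu_{p,q}$ has no rational conserved quantity.
   Context: Everything is over $\mathbb{C}$, and $\mathbb{C}^2\subset\mathbb{CP}^2$ via $(x,y)\mapsto[x:y:1]$. For a birational self-map $f:X\dashrightarrow X$ of a projective algebraic surface, an invariant fibration is a triple $(Y,\rho,g)$ where $Y$ is a projective curve, $\rho:X\dashrightarrow Y$ is a dominant rational map and $g:Y\to Y$ is a regular map such that $\rho\circ f=g\circ\rho$ at each point where the compositions are defined. (Generic fibers of $\rho$ are not required to be irreducible.) A (rational) conserved quantity is the particular case $Y=\mathbb{CP}^1$, $g=\mathrm{Id}$, $\rho\in\mathbb{C}(X)$. *)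

(* Defs.v *)
(* The field of complex numbers is R[i] for R : realType; the definitions are
   stated over an arbitrary algebraically closed field K. *)
From mathcomp Require Import all_boot all_order all_algebra.
From mathcomp Require Import reals.
From mathcomp Require Import complex mpoly ring.

Set Implicit Arguments.
Unset Strict Implicit.
Unset Printing Implicit Defensive.

Import GRing.Theory.
Local Open Scope ring_scope.

(** A point of P^n over K is given by its homogeneous coordinates: a nonzero
    row vector of length n+1, two such vectors being the same point when they
    are [proj_eq]. *)

Section ProjectiveSets.
Variables (K : closedFieldType) (n : nat).

Definition proj_eq (u v : 'rV[K]_n.+1) : Prop :=
  exists2 c : K, c != 0 & u = c *: v.

(** Subsets of P^n are given by the nonzero vectors above them. *)
Definition pset : Type := 'rV[K]_n.+1 -> Prop.

Definition psub (A B : pset) : Prop := forall v, A v -> B v.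

Definition pfull : pset := fun v => v != 0.

(** By noetherianity, allowing an infinite set [S] of equations is harmless. *)
Definition zariski_closed (Y : pset) : Prop :=
  exists2 S : {mpoly K[n.+1]} -> Prop,
    (forall F, S F -> exists d : nat, F \is d.-homog) &
    forall v, Y v <-> v != 0 /\ (forall F, S F -> F.@[v 0] = 0).

Definition zariski_irreducible (Y : pset) : Prop :=
  (exists v, Y v) /\
  forall A B : pset, zariski_closed A -> zariski_closed B ->
    (forall v, Y v -> A v \/ B v) -> psub Y A \/ psub Y B.

(** Chains Z_0 < Z_1 < ... < Z_d of irreducible closed subsets of Y. *)
Definition irr_chain (Y : pset) (d : nat) : Prop :=
  exists Z : nat -> pset,
    (forall i, (i <= d)%N ->
       [/\ zariski_closed (Z i), zariski_irreducible (Z i) & psub (Z i) Y]) /\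
    (forall i, (i < d)%N -> psub (Z i) (Z i.+1) /\ ~ psub (Z i.+1) (Z i)).

Definition krull_dim_eq (Y : pset) (d : nat) : Prop :=
  irr_chain Y d /\ ~ irr_chain Y d.+1.

(** Neither irreducibility nor smoothness is required. *)
Definition projective_curve (Y : pset) : Prop :=
  zariski_closed Y /\ krull_dim_eq Y 1.

End ProjectiveSets.

Section RationalMaps.
Variables (K : closedFieldType).

(** A rational map P^m --> P^n is represented by n+1 forms of the same degree
    in m+1 variables, not all zero. *)
Definition forms (m n : nat) : Type := n.+1.-tuple {mpoly K[m.+1]}.

Definition same_degree m n (F : forms m n) : Prop :=
  exists d : nat, forall i, tnth F i \is d.-homog.

Definition is_ratmap m n (F : forms m n) : Prop :=
  same_degree F /\ exists i, tnth F i != 0.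

Definition same_ratmap m n (F G : forms m n) : Prop :=
  forall i j, tnth F i * tnth G j = tnth F j * tnth G i.

Definition eval_forms m n (F : forms m n) (v : 'rV[K]_m.+1) : 'rV[K]_n.+1 :=
  \row_i (tnth F i).@[v 0].

(** [rat_val F u w]: the rational map [F] is defined at the point [u], where
    its value is the point [w].  It is defined at [u] as soon as one of its
    representatives does not vanish at [u]. *)
Definition rat_val m n (F : forms m n) (u : 'rV[K]_m.+1) (w : 'rV[K]_n.+1) :
  Prop :=
  exists G : forms m n,
    [/\ is_ratmap G, same_ratmap F G, eval_forms G u != 0 &
        proj_eq w (eval_forms G u)].

(** Composition [G \o F] by substitution; it represents the composite rational
    map whenever the result is not identically zero. *)
Definition comp_forms l m n (G : forms m n) (F : forms l m) : forms l n :=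
  [tuple tnth G i \mPo F | i < n.+1].

(** [F] is a rational map from P^m to Y with Zariski dense image. *)
Definition dominant_to m n (F : forms m n) (Y : pset K n) : Prop :=
  [/\ is_ratmap F,
      forall u w, u != 0 -> rat_val F u w -> Y w &
      forall Z : pset K n, zariski_closed Z ->
        (forall u w, u != 0 -> rat_val F u w -> Z w) -> psub Y Z].

(** [g] is a regular map Y -> Y.  The local presentation by forms makes [g w]
    nonzero and independent, as a point, of the choice of coordinates of [w]. *)
Definition regular_selfmap n (Y : pset K n) (g : 'rV[K]_n.+1 -> 'rV[K]_n.+1) :
  Prop :=
  (forall v, Y v -> Y (g v)) /\
  (forall v, Y v ->
     exists G : forms n n,
       [/\ same_degree G, eval_forms G v != 0 &
           forall w, Y w -> eval_forms G w != 0 ->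
             proj_eq (g w) (eval_forms G w)]).

(** (Y, rho, g) is an invariant fibration of the self-map [f] of P^m; in
    the last clause [x2] is f(x), while [y1] and [y2] are rho(x) and
    rho(f(x)). *)
Definition invariant_fibration m n (f : forms m m)
    (Y : pset K n) (rho : forms m n) (g : 'rV[K]_n.+1 -> 'rV[K]_n.+1) : Prop :=
  [/\ projective_curve Y,
      dominant_to rho Y,
      regular_selfmap Y g &
      forall x x2 y1 y2, x != 0 ->
        rat_val f x x2 -> rat_val rho x y1 -> rat_val rho x2 y2 ->
        proj_eq y2 (g y1)].

Definition conserved_quantity m (f : forms m m) (rho : forms m 1) : Prop :=
  invariant_fibration f (@pfull K 1) rho id.

End RationalMaps.

Section Mu.
Variable (K : closedFieldType).

Definition mu1_aff (q : nat) (a : K * K) : K * K := ((1 + a.2 ^+ q) / a.1, a.2).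
Definition mu2_aff (p : nat) (a : K * K) : K * K := (a.1, (1 + a.1 ^+ p) / a.2).

Definition aff (a : K * K) : 'rV[K]_3 := \row_i tnth [tuple a.1; a.2; 1] i.

Let X : {mpoly K[3]} := 'X_(inord 0).
Let Y : {mpoly K[3]} := 'X_(inord 1).
Let Z : {mpoly K[3]} := 'X_(inord 2).

(** Homogenizations of [mu1_aff] and [mu2_aff] (for p, q >= 1), obtained by
    clearing denominators; see [mu_affE]. *)
Definition mu1 (q : nat) : forms K 2 2 :=
  [tuple Z * (Z ^+ q + Y ^+ q); X * Y * Z ^+ q.-1; X * Z ^+ q].
Definition mu2 (p : nat) : forms K 2 2 :=
  [tuple X * Y * Z ^+ p.-1; Z * (Z ^+ p + X ^+ p); Y * Z ^+ p].

Definition mu (p q : nat) : forms K 2 2 := comp_forms (mu2 p) (mu1 q).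

Let Xhomog (i : 'I_3) : ('X_i : {mpoly K[3]}) \is 1.-homog.
Proof. by rewrite dhomogX /= mdeg1. Qed.

Lemma mu1_homog q i : (0 < q)%N -> tnth (mu1 q) i \is q.+1.-homog.
Proof.
have hX k (j : 'I_3) : ('X_j ^+ k : {mpoly K[3]}) \is k.-homog.
  by rewrite -[X in X.-homog]mul1n dhomogMn.
case: q => // q _; case: i => -[|[|[|//]]] Hi; rewrite /tnth /=.
- by rewrite -[q.+2]add1n /Y /Z; apply: dhomogM => //; apply: rpredD; apply: hX.
- rewrite -[q.+2]add2n /X /Y /Z; apply: dhomogM => //.
  by rewrite -[2%N]/(1 + 1)%N; apply: dhomogM.
- by rewrite -[q.+2]add1n /X /Z; apply: dhomogM.
Qed.

Lemma mu_ratmap p q : (0 < p)%N -> (0 < q)%N -> is_ratmap (mu p q).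
Proof.
move=> p_gt0 q_gt0; split.
  exists (q.+1 * p.+1)%N => i; rewrite tnth_mktuple.
  have h1 (j : 'I_3) : ('X_j : {mpoly K[3]}) \mPo mu1 q \is q.+1.-homog.
    by rewrite comp_mpolyXU -tnth_nth mu1_homog.
  have hX k (j : 'I_3) :
      (('X_j : {mpoly K[3]}) \mPo mu1 q) ^+ k \is (q.+1 * k).-homog.
    exact: dhomogMn.
  case: p p_gt0 => // p _; case: i => -[|[|[|//]]] Hi; rewrite /tnth /=;
    rewrite ?(rmorphM, rmorphD, rmorphXn) /=.
  - rewrite (_ : q.+1 * p.+2 = q.+1 + q.+1 + q.+1 * p)%N; last first.
      by rewrite -addnA -!mulnS.
    by rewrite /X /Y /Z; do 2?apply: dhomogM.
  - rewrite [(q.+1 * p.+2)%N]mulnS /X /Y /Z; apply: dhomogM => //.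
    by apply: rpredD; apply: hX.
  - by rewrite [(q.+1 * p.+2)%N]mulnS /X /Y /Z; apply: dhomogM.
have X0 (j : 'I_3) : ('X_j : {mpoly K[3]}) != 0.
  by rewrite -msupp_eq0 msuppX.
have ZY0 : Z ^+ q + Y ^+ q != 0.
  apply/eqP => /(congr1 (meval (fun i => (i == inord 2)%:R))).
  rewrite !(rmorphD, rmorphXn, rmorph0) /= !mevalXU /= -!val_eqE /= !inordK //=.
  by rewrite expr1n expr0n gtn_eqF // addr0 => /eqP; rewrite oner_eq0.
exists ord0; rewrite tnth_mktuple /tnth /=.
rewrite ?(rmorphM, rmorphXn) /= !comp_mpolyXU !inordK //=.
by rewrite !(mulf_neq0, expf_neq0) // ?X0.
Qed.

Lemma mu_affE p q (x y : K) : (0 < p)%N -> (0 < q)%N -> x != 0 -> y != 0 ->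
  rat_val (mu p q) (aff (x, y)) (aff (mu2_aff p (mu1_aff q (x, y)))).
Proof.
move=> p_gt0 q_gt0 x0 y0.
set v := aff (x, y); set w := aff _.
have vE : ((v 0 (inord 0) = x) * (v 0 (inord 1) = y) * (v 0 (inord 2) = 1))%type.
  by rewrite !mxE /tnth /= !inordK.
suff E : eval_forms (mu p q) v = (x ^+ p.+1 * y) *: w.
  have c0 : x ^+ p.+1 * y != 0 by rewrite mulf_neq0 ?expf_neq0.
  exists (mu p q); rewrite E; split=> //.
  - exact: mu_ratmap.
  - by move=> i j; rewrite mulrC.
  - rewrite scaler_eq0 negb_or c0 /=.
    apply/eqP => /rowP /(_ (inord 2)); rewrite !mxE /tnth /= inordK //=.
    by move/eqP; rewrite oner_eq0.
  - by exists (x ^+ p.+1 * y)^-1; rewrite ?invr_eq0 // scalerA mulVf ?scale1r.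
have yM a : y * (a / y) = a by rewrite mulrCA mulfV ?mulr1.
have xM : (1 + y ^+ q) = x * ((1 + y ^+ q) / x) by rewrite mulrCA mulfV ?mulr1.
have xK a : x * a / x = a by rewrite mulrAC mulfV ?mul1r.
apply/rowP => i; rewrite !mxE tnth_mktuple comp_mpoly_meval.
case: i => -[|[|[|//]]] Hi; rewrite /tnth /= ?(rmorphM, rmorphD, rmorphXn) /=;
  rewrite !mevalXU /tnth /= !inordK //=;
  rewrite ?(rmorphM, rmorphD, rmorphXn) /= !mevalXU !vE ?expr1n ?mulr1 ?mul1r 1?xM ?xK;
  set t := (1 + y ^+ q) / x.
- case: p p_gt0 {w} => // p _ /=.
  by rewrite !exprS; ring.
- by rewrite -[RHS]mulrA yM exprMn exprS; ring.
- by rewrite exprS; ring.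
Qed.

End Mu.

(* Main.v *)
Require Import Defs.
From mathcomp Require Import all_boot all_order all_algebra.
From mathcomp Require Import boolp reals.
From mathcomp Require Import complex mpoly.
From mathcomp Require Import zify ring lra.

Set Implicit Arguments.
Unset Strict Implicit.
Unset Printing Implicit Defensive.

Import Order.TTheory GRing.Theory Num.Theory.
Local Open Scope ring_scope.

(** Give the affine coordinates x and y the real weights q and 1 + l, where
    l > 1 satisfies l^2 = (pq - 2) l - 1. Since pq > 4, the number l is
    irrational, so the two weights are independent over the rationals: a nonzero
    form has a single heaviest monomial, and sending a quotient of two forms of
    the same degree to the difference of the weights of these monomials defines,
    up to sign, a valuation v of the function field of the plane, of rational
    rank two. Where 1 is negligible against x^p and y^q, the map mu acts on
    weights by (a, b) |-> (q b - a, p (q b - a) - b), a linear map of determinant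
    1 and trace pq - 2 having (q, 1 + l) as eigenvector for the eigenvalue l.
    Hence v (h o mu) = l v(h) for every rational function h ([mu_lead] and
    [leadw_comp]).

    Suppose that rho o mu = g o rho with rho dominant onto a curve Y, and let
    h = (rho_i - c rho_j) / rho_j. Both h and h o mu are pulled back from Y by
    rho, so they are algebraically dependent ([curve_forms_dependence]). In a
    polynomial relation between them two terms have the same valuation, which
    makes v(h) and l v(h) dependent over the rationals, so v(h) = 0
    ([equal_weights]). Take c = 0: rho_i and rho_j have the same heaviest
    monomial. Then a suitable constant c cancels it in rho_i - c rho_j, and for
    this c either v(h) <> 0 or h = 0. So rho_i and rho_j are proportional for all
    i and j, and rho is constant: a contradiction.

    The algebraic dependence has to come from the definition of a curve by
    chains of irreducible closed sets. If rho is not constant on a line, the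
    closure of the image of this line strictly contains a point; were it strictly
    smaller than the closure of the image of rho, then Y would contain a chain of
    length 2. Therefore a form that vanishes on the image of the line vanishes on
    the whole image ([vanish_on_line]). On a line only polynomials in one
    variable remain, for which counting dimensions gives a relation
    ([bimonomial_dependence]). *)

(** * Nonzero polynomials have nonzero values *)

Section Points.

Lemma base_expansion_inj n D (f g : 'I_n -> nat) :
  (forall i, (f i < D)%N) -> (forall i, (g i < D)%N) ->
  (\sum_i f i * D ^ i = \sum_i g i * D ^ i)%N -> f =1 g.
Proof.
elim: n f g => [|n IHn] f g fD gD; first by move=> _ [].
have shift (h : 'I_n.+1 -> nat) :
    (\sum_i h i * D ^ i = (\sum_(i < n) h (lift ord0 i) * D ^ i) * D + h ord0)%N.
  rewrite big_ord_recl muln1 addnC big_distrl /=; congr addn.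
  by apply: eq_bigr => i _; rewrite expnSr mulnA.
have D0 : (0 < D)%N by apply: leq_trans (fD ord0).
rewrite !shift => E.
have E0 : f ord0 = g ord0.
  by move/(congr1 (modn^~ D)): E; rewrite !modnMDl !modn_small.
move: E; rewrite E0 => /addIn /eqP; rewrite eqn_pmul2r // => /eqP E i.
case: (unliftP ord0 i) => [j|] -> //.
by apply: (IHn (f \o lift ord0) (g \o lift ord0)) => // k; [apply: fD|apply: gD].
Qed.

Variable K : closedFieldType.

(** Kronecker substitution: replacing X_i by T^(D^i), with D larger than every
    exponent of P, sends the monomials of P to distinct powers of T. *)
Lemma mpoly_nonzero_point n (P : {mpoly K[n]}) :
  P != 0 -> exists v : 'rV[K]_n, P.@[v 0] != 0.
Proof.
move=> P0; set D := msize P.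
pose kr (m : 'X_{1..n}) := (\sum_i m i * D ^ i)%N.
have kr_inj : {in msupp P &, injective kr}.
  move=> m m' mP m'P E; apply/mnmP.
  have small k (kP : k \in msupp P) i : (k i < D)%N.
    apply: leq_ltn_trans (msize_mdeg_lt kP).
    by rewrite mdegE (bigD1 i) //= leq_addr.
  by apply: (base_expansion_inj _ _ E) => i; apply: small.
pose u := \sum_(m <- msupp P) P@_m *: 'X^(kr m) : {poly K}.
have u0 : u != 0.
  have mP := mlead_supp P0; set m0 := mlead P in mP.
  apply/eqP => /(congr1 (coefp (kr m0))) /eqP; rewrite /= coef0 coef_sum.
  rewrite (bigD1_seq m0) ?msupp_uniq //= big_seq_cond big1 ?addr0.
    by rewrite coefZ coefXn eqxx mulr1 mcoeff_eq0 mP.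
  move=> m /andP[mS mm0]; rewrite coefZ coefXn.
  by case: eqP => [/esym/kr_inj E|]; rewrite ?mulr0 // -E ?eqxx in mm0 *.
have [t ut] := closed_nonrootP _ u0.
exists (\row_i t ^+ (D ^ i)).
apply: contraNneq ut; rewrite rootE mevalE => <-.
apply/eqP; rewrite horner_sum; apply: eq_bigr => m _; rewrite hornerZ hornerXn.
congr (_ * _); rewrite /kr -prodrXr; apply: eq_bigr => i _.
by rewrite mxE mulnC exprM.
Qed.

Lemma mpoly_fun0 n (P : {mpoly K[n]}) : (forall v : 'rV[K]_n, P.@[v 0] = 0) -> P = 0.
Proof.
by move=> Pv; apply/eqP/contraT => /mpoly_nonzero_point[v]; rewrite Pv eqxx.
Qed.

End Points.

(** * Leading monomials for real weights *)

Section Weights.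
Variables (K : idomainType) (R : realDomainType).

Section OneWeight.
Variables (n : nat) (w : 'I_n -> R).

Definition weight (m : 'X_{1..n}) : R := \sum_i w i *+ m i.

Lemma weight0 : weight 0%MM = 0.
Proof. by rewrite /weight big1 // => i _; rewrite mnm0E. Qed.

Lemma weightD m m' : weight (m + m')%MM = weight m + weight m'.
Proof. by rewrite /weight -big_split; apply: eq_bigr => i _; rewrite mnmDE mulrnDr. Qed.

Definition below (P : {mpoly K[n]}) (r : R) : Prop :=
  {in msupp P, forall m, weight m < r}.

Lemma below0 r : below 0 r.
Proof. by move=> m; rewrite msupp0. Qed.

Lemma belowD P Q r : below P r -> below Q r -> below (P + Q) r.
Proof.
by move=> PB QB m /msuppD_le; rewrite mem_cat => /orP[/PB|/QB].
Qed.

Lemma belowZ c P r : below P r -> below (c *: P) r.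
Proof. by move=> PB m /msuppZ_le/PB. Qed.

Lemma belowXM m P r : below P r -> below ('X_[m] * P) (weight m + r).
Proof.
move=> PB m' /msuppM_le/allpairsP[[m1 m2] /= [/mem_msuppXP <- /PB m2r ->]].
by rewrite weightD ltrD2l.
Qed.

Lemma belowM P Q r s : below P r -> below Q s -> below (P * Q) (r + s).
Proof.
move=> PB QB m /msuppM_le/allpairsP[[m1 m2] /= [/PB m1r /QB m2s ->]].
by rewrite weightD ltrD.
Qed.

Lemma below_sum (I : eqType) (r : seq I) (F : I -> {mpoly K[n]}) b :
  {in r, forall i, below (F i) b} -> below (\sum_(i <- r) F i) b.
Proof.
move=> FB; rewrite big_seq; elim/big_rec: _ => [|i P /FB]; [exact: below0|exact: belowD].
Qed.

(** Isolating a single monomial, instead of a whole initial form, makes the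
    leading part of a product visibly nonzero. *)
Definition lead (P : {mpoly K[n]}) (m : 'X_{1..n}) : Prop :=
  exists2 c, c != 0 & below (P - c *: 'X_[m]) (weight m).

Lemma lead_supp P m : lead P m -> m \in msupp P.
Proof.
case=> c c0 PB; apply: contraT => mP; have := PB m.
rewrite mcoeff_msupp mcoeffB mcoeffZ mcoeffX eqxx mulr1 (memN_msupp_eq0 mP).
by rewrite sub0r oppr_eq0 c0 ltxx => /(_ isT).
Qed.

Lemma lead_neq0 P m : lead P m -> P != 0.
Proof. by move/lead_supp; apply: contraTneq => ->; rewrite msupp0. Qed.

Lemma lead_max P m m' : lead P m -> m' \in msupp P -> m' != m -> weight m' < weight m.
Proof.
case=> c c0 PB m'P m'm; apply: PB.
rewrite mcoeff_msupp mcoeffB mcoeffZ mcoeffX [m == _]eq_sym (negbTE m'm) mulr0 subr0.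
by rewrite -mcoeff_msupp.
Qed.

Lemma lead_uniq P m m' : lead P m -> lead P m' -> m = m'.
Proof.
move=> Pm Pm'; apply/eqP/contraT => mm'.
have := lead_max Pm' (lead_supp Pm) mm'; rewrite eq_sym in mm'.
by move=> /lt_trans/(_ (lead_max Pm (lead_supp Pm') mm')); rewrite ltxx.
Qed.

Lemma lead_exists P : P != 0 -> {in msupp P &, injective weight} -> exists m, lead P m.
Proof.
move=> P0 inj; have [m0 m0P] : exists m0, m0 \in msupp P.
  by exists (mlead P); apply: mlead_supp.
have [m mP mmax] : exists2 m, m \in msupp P & {in msupp P, forall m', weight m' <= weight m}.
  elim: (msupp P) m0 m0P {inj} => // a s IHs _ _.
  case: s IHs => [_|b s /(_ b (mem_head _ _))[m ms mmax]].
    by exists a => [|m']; rewrite mem_seq1 // => /eqP ->.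
  case: (leP (weight a) (weight m)) => am.
    exists m => [|m']; rewrite in_cons ?ms ?orbT // => /predU1P[-> //|]; exact: mmax.
  exists a => [|m']; rewrite in_cons ?eqxx // => /predU1P[-> //|/mmax ma].
  exact: le_trans ma (ltW am).
exists m; exists P@_m; first by rewrite -mcoeff_msupp.
move=> m'; rewrite (perm_mem (msupp_rem P m)) mem_rem_uniq ?msupp_uniq // => /andP[/= m'm m'P].
rewrite lt_neqAle mmax // andbT; apply: contraNneq m'm => /inj -> //=.
Qed.

Definition leadw P r := exists2 m, lead P m & weight m = r.

Lemma leadw_uniq P r s : leadw P r -> leadw P s -> r = s.
Proof. by move=> [m Pm <-] [m' Pm' <-]; rewrite (lead_uniq Pm Pm'). Qed.

Lemma leadw_neq0 P r : leadw P r -> P != 0.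
Proof. by case=> m /lead_neq0. Qed.

Lemma leadwX m : leadw 'X_[m] (weight m).
Proof. by exists m => //; exists 1; rewrite ?oner_neq0 // scale1r subrr; apply: below0. Qed.

Lemma leadw1 : leadw 1 0.
Proof. by rewrite -mpolyX0 -weight0; apply: leadwX. Qed.

Lemma leadwXU i : leadw 'X_i (w i).
Proof.
suff <- : weight U_(i)%MM = w i by apply: leadwX.
rewrite /weight (bigD1 i) //= big1 ?addr0 ?mnm1E ?eqxx // => j ji.
by rewrite mnm1E eq_sym (negbTE ji).
Qed.

Lemma leadwZ c P r : c != 0 -> leadw P r -> leadw (c *: P) r.
Proof.
move=> c0 [m [d d0 PB] <-]; exists m => //; exists (c * d); first by rewrite mulf_neq0.
by rewrite -scalerA -scalerBr; apply: belowZ.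
Qed.

Lemma leadwD P Q r : leadw P r -> below Q r -> leadw (P + Q) r.
Proof.
move=> [m [c c0 PB] <-] QB; exists m => //; exists c => //.
by rewrite addrAC; apply: belowD.
Qed.

Lemma leadwM P Q r s : leadw P r -> leadw Q s -> leadw (P * Q) (r + s).
Proof.
move=> [m [c c0 PB] <-] [m' [c' c'0 QB] <-]; exists (m + m')%MM; last exact: weightD.
exists (c * c'); first by rewrite mulf_neq0.
set L := P - _ in PB; set L' := Q - _ in QB.
have -> : P * Q - (c * c') *: 'X_[m + m'] =
    L * L' + (c *: ('X_[m] * L') + c' *: ('X_[m'] * L)).
  rewrite /L /L' mpolyXD -!mul_mpolyC mpolyCM; ring.
rewrite weightD; apply: belowD; first exact: belowM.
apply: belowD; apply: belowZ; first exact: belowXM.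
by rewrite addrC; apply: belowXM.
Qed.

Lemma leadwXn P r k : leadw P r -> leadw (P ^+ k) (r *+ k).
Proof.
move=> Pr; elim: k => [|k IHk]; first by rewrite mulr0n; apply: leadw1.
by rewrite exprS mulrS; apply: leadwM.
Qed.

Lemma leadw_prod (I : Type) (s : seq I) (F : I -> {mpoly K[n]}) (r : I -> R) :
  (forall i, leadw (F i) (r i)) -> leadw (\prod_(i <- s) F i) (\sum_(i <- s) r i).
Proof.
move=> Fr; elim: s => [|i s IHs]; first by rewrite !big_nil; apply: leadw1.
by rewrite !big_cons; apply: leadwM.
Qed.

Lemma leadw_below P r s : leadw P r -> r < s -> below P s.
Proof.
move=> [m Pm <-] ms m' m'P; case: (eqVneq m' m) => [-> //|m'm].
exact: lt_trans (lead_max Pm m'P m'm) ms.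
Qed.

Lemma leadw_dominant P Q r s :
  leadw P r -> leadw Q s -> r < s -> leadw (P + Q) s.
Proof. by move=> Pr Qs rs; rewrite addrC; apply: leadwD => //; apply: leadw_below Pr rs. Qed.

(** The ultrametric principle: terms of pairwise distinct weights cannot
    cancel. *)
Lemma leadw_sum_neq0 (I : finType) (F : I -> {mpoly K[n]}) (r : I -> R)
    (c : I -> K) :
  (forall i, leadw (F i) (r i)) -> injective r -> (exists i, c i != 0) ->
  \sum_i c i *: F i != 0.
Proof.
move=> Fr r_inj [i0 ci0].
case: (@Order.TotalTheory.arg_maxP _ _ _ i0 (fun i => c i != 0) r ci0) => i ci imax.
apply: (@leadw_neq0 _ (r i)); rewrite (bigD1 i) //=.
apply: leadwD; first exact: leadwZ.
rewrite -big_filter; apply: below_sum => j; rewrite mem_filter => /andP[ji _].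
have [->|cj] := eqVneq (c j) 0; first by rewrite scale0r; apply: below0.
apply/belowZ/(leadw_below (Fr j)).
by rewrite lt_neqAle (inj_eq r_inj) ji; apply: imax.
Qed.

End OneWeight.

(** The functoriality of the valuation: if substituting F changes the weights of
    the variables affinely, with positive slope l, then it preserves the order of
    the monomials of a given degree. The shift [kap] accounts for the common
    factor of the homogeneous coordinates. *)
Lemma leadw_comp n k (w : 'I_n -> R) (w' : 'I_k -> R) (F : n.-tuple {mpoly K[k]})
    (l kap : R) (P : {mpoly K[n]}) d r :
  0 < l -> (forall i, leadw w' (tnth F i) (l * w i + kap)) ->
  P \is d.-homog -> leadw w P r -> leadw w' (P \mPo F) (l * r + kap *+ d).
Proof.
move=> l0 Fr Pd [m Pm <-].
have monom m' : leadw w' ('X_[m'] \mPo F) (l * weight w m' + kap *+ mdeg m').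
  rewrite comp_mpolyX.
  have -> : l * weight w m' + kap *+ mdeg m' = \sum_i (l * w i + kap) *+ m' i.
    rewrite /weight mdegE -sumrMnr mulr_sumr -big_split; apply: eq_bigr => i _ /=.
    by rewrite mulrnDl mulrnAr.
  by apply: leadw_prod => i; apply: leadwXn.
have mP := lead_supp Pm.
rewrite [P]mpolyE rmorph_sum /= (bigD1_seq m) ?msupp_uniq //= !comp_mpolyZ.
apply: leadwD.
  apply: leadwZ; first by rewrite -mcoeff_msupp.
  by rewrite -(dhomog_mf Pd mP).
rewrite -big_filter; apply: below_sum => m'; rewrite mem_filter => /andP[m'm m'P].
rewrite comp_mpolyZ; apply/belowZ/(leadw_below (monom m')).
by rewrite (dhomog_mf Pd m'P) ltrD2r ltr_pM2l // (lead_max Pm).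
Qed.

End Weights.

(** * Algebraic dependence of polynomials in one variable *)

Section Dependence.
Variable K : fieldType.

Lemma linear_dependence (I : finType) (F : I -> {poly K}) M :
  (forall i, (size (F i) <= M)%N) -> (M < #|I|)%N ->
  exists2 c : I -> K, (exists i, c i != 0) & \sum_i c i *: F i = 0.
Proof.
move=> FM MI; pose A := \matrix_(i < #|I|) poly_rV (F (enum_val i)) : 'M[K]_(_, M).
have : kermx A != 0.
  rewrite kermx_eq0 /row_free neq_ltn; apply/orP; left.
  exact: leq_ltn_trans (rank_leq_col A) MI.
case/rowV0Pn => u /sub_kermxP uA /rV0Pn[k uk].
exists (fun i => u 0 (enum_rank i)); first by exists (enum_val k); rewrite enum_valK.
transitivity (rVpoly (u *m A)); last by rewrite uA raddf0.
rewrite mulmx_sum_row linear_sum /= (reindex _ (onW_bij _ (@enum_val_bij I))).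
apply: eq_bigr => i _; rewrite enum_valK linearZ /= rowK; congr (_ *: _).
by rewrite poly_rV_K.
Qed.

(** With N = 2 s + 1, where s bounds the four sizes, there are (N + 1)^2
    products, all of degree at most 2 s N < (N + 1)^2 - 1. The relation is the
    bihomogeneous form of a polynomial relation between h1 / h2 and h3 / h4. *)
Lemma bimonomial_dependence (h1 h2 h3 h4 : {poly K}) :
  exists N, exists2 c : 'I_N.+1 * 'I_N.+1 -> K, (exists i, c i != 0) &
    \sum_i c i *: (h1 ^+ i.1 * h2 ^+ (N - i.1) * (h3 ^+ i.2 * h4 ^+ (N - i.2))) = 0.
Proof.
set s := (size h1 + size h2 + size h3 + size h4)%N.
exists (s.*2.+1); set N := s.*2.+1.
apply: (@linear_dependence _ _ (s * N + s * N).+1); last first.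
  by rewrite card_prod card_ord /N; nia.
have szX (h : {poly K}) k : (size h <= s)%N -> (size (h ^+ k) <= (s * k).+1)%N.
  move=> hs; apply: leq_trans (size_poly_exp_leq _ _) _.
  by rewrite ltnS leq_mul2r (leq_trans (leq_pred _)) ?orbT.
have szM (h h' : {poly K}) a b :
    (size h <= a.+1)%N -> (size h' <= b.+1)%N -> (size (h * h')%R <= (a + b).+1)%N.
  by move=> ha hb; apply: leq_trans (size_polyMleq _ _) _; lia.
have szN (h h' : {poly K}) (a : 'I_N.+1) : (size h <= s)%N -> (size h' <= s)%N ->
    (size (h ^+ a * h' ^+ (N - a))%R <= (s * N).+1)%N.
  move=> hs h's; have -> : (s * N = s * a + s * (N - a))%N.
    by rewrite -mulnDr subnKC // -ltnS.
  by apply: szM; apply: szX.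
by move=> [a b] /=; apply: szM; apply: szN; rewrite /s; lia.
Qed.

End Dependence.

(** * Closures of parametrized families of points *)

Section Homogeneity.
Variable K : closedFieldType.

Lemma meval_homog n (F : {mpoly K[n.+1]}) d c (v : 'rV[K]_n.+1) :
  F \is d.-homog -> F.@[(c *: v) 0] = c ^+ d * F.@[v 0].
Proof.
move=> Fd; rewrite !mevalE mulr_sumr !big_seq; apply: eq_bigr => k kF.
rewrite mulrCA; congr (_ * _).
under eq_bigr do rewrite mxE exprMn.
by rewrite big_split /= prodrXr -mdegE (dhomog_mf Fd kF).
Qed.

Lemma closed_scale n (Y : pset K n) c v : zariski_closed Y -> c != 0 -> Y v -> Y (c *: v).
Proof.
case=> S Shom YS c0 /YS[v0 vS]; apply/YS; split.
  by rewrite scaler_eq0 negb_or c0.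
by move=> F SF; have [d Fd] := Shom F SF; rewrite (meval_homog _ _ Fd) vS ?mulr0.
Qed.

Lemma ratmap_value m n (F : forms K m n) x :
  is_ratmap F -> eval_forms F x != 0 -> rat_val F x (eval_forms F x).
Proof.
move=> Frat x0; exists F; split=> //; first by move=> i j; rewrite mulrC.
by exists 1; rewrite ?oner_neq0 ?scale1r.
Qed.

End Homogeneity.

Section Closures.
Variables (K : closedFieldType) (n : nat).

(** The vector [phi t] may be 0, as happens for the forms representing a rational
    map at its base points. *)
Definition zclosure (T : Type) (phi : T -> 'rV[K]_n.+1) : pset K n := fun v =>
  v != 0 /\ forall (F : {mpoly K[n.+1]}) (d : nat), F \is d.-homog ->
    (forall t, F.@[phi t 0] = 0) -> F.@[v 0] = 0.

(** Primality, properness aside, of the ideal of the family. *)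
Definition prime_family (T : Type) (phi : T -> 'rV[K]_n.+1) : Prop :=
  forall F G : {mpoly K[n.+1]}, (forall t, (F * G).@[phi t 0] = 0) ->
    (forall t, F.@[phi t 0] = 0) \/ (forall t, G.@[phi t 0] = 0).

Section Family.
Variables (T : Type) (phi : T -> 'rV[K]_n.+1).

Lemma zclosure_closed : zariski_closed (zclosure phi).
Proof.
exists (fun F => (exists d : nat, F \is d.-homog) /\ forall t, F.@[phi t 0] = 0).
  by move=> F [].
move=> v; split=> [[v0 vF]|[v0 vF]]; split=> //.
  by move=> F [[d Fd] F0]; apply: vF Fd F0.
by move=> F d Fd F0; apply: vF; split=> //; exists d.
Qed.

Lemma zclosure_in t : phi t != 0 -> zclosure phi (phi t).
Proof. by move=> t0; split=> // F d _ ->. Qed.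

Lemma zclosure_min Y :
  zariski_closed Y -> (forall t, phi t != 0 -> Y (phi t)) -> psub (zclosure phi) Y.
Proof.
case=> S Shom YS phiY v [v0 vF]; apply/YS; split=> // F SF.
have [d Fd] := Shom F SF.
have [k vk] := rV0Pn _ v0.
(* The factor 'X_k makes F vanish also where phi t = 0. *)
have : (F * 'X_k).@[v 0] = 0.
  apply: (vF _ (d + 1)%N); first by apply: dhomogM => //; rewrite dhomogX /= mdeg1.
  move=> t; rewrite mevalM mevalXU; have [->|/phiY/YS[_ /(_ _ SF) ->]] := eqVneq (phi t) 0.
    by rewrite mxE mulr0.
  by rewrite mul0r.
by move/eqP; rewrite mevalM mevalXU mulf_eq0 (negbTE vk) orbF => /eqP.
Qed.

Hypothesis phiP : prime_family phi.
Hypothesis phi_neq0 : exists t, phi t != 0.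

(** A form of degree 0 does not vanish at the zero vector, so a witness for F
    alone might not be a point; a witness for F * 'X_k is one. *)
Lemma prime_family_witness (F : {mpoly K[n.+1]}) :
  (exists t, F.@[phi t 0] != 0) -> exists2 t, phi t != 0 & F.@[phi t 0] != 0.
Proof.
move=> [t1 Ft1]; have [t0 /rV0Pn[k t0k]] := phi_neq0.
have [E|/forallNP E] := pselect (exists t, (F * 'X_k).@[phi t 0] != 0).
  have [t] := E; rewrite mevalM mevalXU mulf_eq0 negb_or => /andP[Ft tk].
  by exists t => //; apply: contraNneq tk => ->; rewrite mxE.
have /phiP[H|H] : forall t, (F * 'X_k).@[phi t 0] = 0.
- by move=> t; apply/eqP/negPn/negP; apply: E.
- by rewrite H eqxx in Ft1.
- by have := H t0; rewrite mevalXU => /eqP; rewrite (negbTE t0k).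
Qed.

(** If the closure is contained in neither A nor B, some F vanishing on A and
    some G vanishing on B are both nonzero on the family; by primality so is F * G,
    which vanishes on the union. *)
Lemma zclosure_irreducible : zariski_irreducible (zclosure phi).
Proof.
split; first by have [t0] := phi_neq0; exists (phi t0); apply: zclosure_in.
move=> A B Acl Bcl cover.
have escape Z : zariski_closed Z -> ~ psub (zclosure phi) Z ->
    exists2 F : {mpoly K[n.+1]}, (forall v, Z v -> F.@[v 0] = 0) & exists t, F.@[phi t 0] != 0.
  move=> Zcl nZ; apply: contrapT => H; apply: nZ; apply: zclosure_min => // t t0.
  have [S Shom ZS] := Zcl; apply/ZS; split=> // F SF.
  apply/eqP/negPn/negP => Ft; apply: H; exists F; last by exists t.
  by move=> v /ZS[_]; apply.
have [|nA] := pselect (psub (zclosure phi) A); first by left.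
have [|nB] := pselect (psub (zclosure phi) B); first by right.
have [F FA [t1 Ft1]] := escape A Acl nA; have [G GB [t2 Gt2]] := escape B Bcl nB.
have [|t t0] := @prime_family_witness (F * G).
  apply: contrapT => /forallNP H; have /phiP[H'|H'] : forall t, (F * G).@[phi t 0] = 0.
  - by move=> t; apply/eqP/negPn/negP; apply: H.
  - by rewrite H' eqxx in Ft1.
  - by rewrite H' eqxx in Gt2.
by rewrite mevalM; case: (cover _ (zclosure_in t0)) => [/FA|/GB] ->;
  rewrite ?mul0r ?mulr0 eqxx.
Qed.

End Family.

Lemma prime_family_point (v : 'rV[K]_n.+1) : prime_family (fun _ : unit => v).
Proof.
move=> F G /(_ tt) /eqP; rewrite mevalM mulf_eq0.
by case/orP=> /eqP FG; [left|right].
Qed.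

Lemma meval_eval_forms m (rho : forms K m n) F x :
  F.@[eval_forms rho x 0] = (F \mPo rho).@[x 0].
Proof. by rewrite comp_mpoly_meval; apply: meval_eq => i; rewrite mxE. Qed.

Lemma prime_family_forms m (rho : forms K m n) : prime_family (eval_forms rho).
Proof.
move=> F G FG; have /eqP : (F * G) \mPo rho = 0.
  by apply: mpoly_fun0 => x; rewrite -meval_eval_forms.
rewrite rmorphM mulf_eq0 => /orP[] /eqP E; [left|right] => x;
  by rewrite meval_eval_forms E meval0.
Qed.

End Closures.

Section Lines.
Variables (K : closedFieldType) (m : nat) (u w : 'rV[K]_m.+1).

Definition line_pt (s : K) : 'rV[K]_m.+1 := u + s *: (w - u).

Definition line_coord (i : 'I_m.+1) : {poly K} := (u 0 i)%:P + (w 0 i - u 0 i) *: 'X.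

Definition restrict : {mpoly K[m.+1]} -> {poly K} := mmap (@polyC K) line_coord.

Lemma horner_restrict P s : (restrict P).[s] = P.@[line_pt s 0].
Proof.
rewrite /restrict /mmap mevalE horner_sum; apply: eq_bigr => k _.
rewrite hornerM hornerC; congr (_ * _); rewrite /mmap1 horner_prod.
apply: eq_bigr => i _; rewrite horner_exp; congr (_ ^+ _).
by rewrite /line_coord hornerD hornerC hornerZ hornerX !mxE mulrC.
Qed.

Lemma poly_fun0 (h : {poly K}) : (forall s, h.[s] = 0) -> h = 0.
Proof.
by move=> h0; apply/eqP/contraT => /closed_nonrootP[s]; rewrite rootE h0 eqxx.
Qed.

Lemma prime_family_line n (rho : forms K m n) :
  prime_family (fun s => eval_forms rho (line_pt s)).
Proof.
move=> F G FG; have /eqP : restrict (F \mPo rho) * restrict (G \mPo rho) = 0.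
  apply: poly_fun0 => s; rewrite hornerM !horner_restrict -!meval_eval_forms.
  by rewrite -mevalM.
rewrite mulf_eq0 => /orP[] /eqP E; [left|right] => s;
  by rewrite meval_eval_forms -horner_restrict E horner0.
Qed.

End Lines.

(** * Rational maps onto a curve *)

Section Curves.
Variables (K : closedFieldType) (m n : nat) (Y : pset K n) (rho : forms K m n).
Hypothesis Ycurve : projective_curve Y.
Hypothesis rhoY : dominant_to rho Y.

(** The linear forms in y whose vanishing says that y is proportional to v. *)
Let minor (v : 'rV[K]_n.+1) i j : {mpoly K[n.+1]} := v 0 i *: 'X_j - v 0 j *: 'X_i.

Let minor_homog v i j : minor v i j \is 1.-homog.
Proof. by apply: rpredB; apply: rpredZ; rewrite dhomogX /= mdeg1. Qed.

Let minorE v i j (y : 'rV[K]_n.+1) : (minor v i j).@[y 0] = v 0 i * y 0 j - v 0 j * y 0 i.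
Proof. by rewrite mevalB !mevalZ !mevalXU. Qed.

Lemma proj_point (v y : 'rV[K]_n.+1) : v != 0 ->
  zclosure (fun _ : unit => v) y -> proj_eq y v.
Proof.
move=> v0 [y0 yv]; have [k vk] := rV0Pn _ v0.
have E i : v 0 k * y 0 i = v 0 i * y 0 k.
  apply/eqP; rewrite -subr_eq0 -minorE; apply/eqP.
  by apply: (yv _ 1%N) => // _; rewrite minorE mulrC subrr.
have yE : y = (y 0 k / v 0 k) *: v.
  apply/rowP => i; rewrite mxE; apply: (mulfI vk).
  by rewrite E mulrCA mulrA divfK // mulrC.
exists (y 0 k / v 0 k) => //; apply: contraNneq y0 => c0.
by rewrite yE c0 scale0r.
Qed.

Lemma ratmap_point : exists x, eval_forms rho x != 0.
Proof.
case: rhoY => [[_ [k /mpoly_nonzero_point[x xk]]] _ _]; exists x.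
by apply: contraNneq xk => /rowP/(_ k); rewrite !mxE => ->.
Qed.

(** Only the zero vector x is not covered by the dominance hypothesis: then rho
    has degree 0, and it takes the same value at every point. *)
Lemma ratmap_in_curve x : eval_forms rho x != 0 -> Y (eval_forms rho x).
Proof.
case: rhoY => rhorat inY _ vx; have [[d rhod] _] := rhorat.
have [x0|x0] := eqVneq x 0; last exact: inY _ _ x0 (ratmap_value rhorat vx).
have rho0 k : (tnth rho k).@[x 0] = 0 ^+ d * (tnth rho k).@[(const_mx 1 : 'rV_m.+1) 0].
  by rewrite -(meval_homog 0 _ (rhod k)) scale0r x0.
have [k] := rV0Pn _ vx; rewrite mxE rho0 expr0n.
case: (d =P 0%N) => [d0 _|_]; last by rewrite mul0r eqxx.
have E : eval_forms rho x = eval_forms rho (const_mx 1).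
  by apply/rowP => i; rewrite !mxE rho0 d0 expr0 mul1r.
rewrite E in vx *; apply: (inY _ _ _ (ratmap_value rhorat vx)).
by apply/rV0Pn; exists ord0; rewrite mxE oner_neq0.
Qed.

(** Otherwise the dense image of rho is a single point, and a point contains no
    chain of length 1. *)
Lemma ratmap_nonconstant : exists (u w : 'rV[K]_m.+1) i j,
  (tnth rho i).@[u 0] * (tnth rho j).@[w 0] != (tnth rho j).@[u 0] * (tnth rho i).@[w 0].
Proof.
apply: contrapT => const.
have {}const (u w : 'rV[K]_m.+1) i j :
    (tnth rho i).@[u 0] * (tnth rho j).@[w 0] = (tnth rho j).@[u 0] * (tnth rho i).@[w 0].
  by apply/eqP/negPn/negP => ne; apply: const; exists u, w, i, j.
have [x0 vx0] := ratmap_point; set a := eval_forms rho x0 in vx0.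
have [k ak] := rV0Pn _ vx0.
pose Z := zclosure (fun _ : unit => a).
have YZ : psub Y Z.
  case: rhoY => _ _; apply; first exact: zclosure_closed.
  move=> u w u0 [G [_ FG Gu0 [c c0 ->]]].
  have rk0 : tnth rho k != 0.
    by apply: contraNneq ak => E; rewrite mxE E meval0.
  have E j : a 0 k *: tnth G j = a 0 j *: tnth G k.
    apply: (mulfI rk0); rewrite -!scalerAr (FG k j) !scalerAl; congr (_ * _).
    apply/eqP; rewrite -subr_eq0; apply/eqP/mpoly_fun0 => x; rewrite mevalB !mevalZ !mxE.
    by rewrite mulrC const mulrC subrr.
  have Ga : eval_forms G u = ((tnth G k).@[u 0] / a 0 k) *: a.
    apply/rowP => j; rewrite [LHS]mxE [RHS]mxE; apply: (mulfI ak).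
    by rewrite -mevalZ E mevalZ mulrAC [RHS]mulrC divfK // mulrC.
  have {Ga}Ga : exists2 b, b != 0 & eval_forms G u = b *: a.
    eexists; last exact: Ga.
    by apply: contraNneq Gu0 => b0; rewrite Ga b0 scale0r.
  have [b b0 ->] := Ga; rewrite scalerA.
  apply: closed_scale; [exact: zclosure_closed| by rewrite mulf_neq0|].
  exact: (@zclosure_in _ _ _ (fun _ : unit => a) tt).
case: Ycurve => _ [[C [Ccl Cinc]] _].
have [_ [[z0 Cz0] _] _] := Ccl 0%N isT; have [Z1 _ Z1Y] := Ccl 1%N isT.
have [C01 nC10] := Cinc 0%N isT; apply: nC10 => z1 Cz1.
have [b b0 z1E] := proj_point vx0 (YZ _ (Z1Y _ Cz1)).
have [c c0 z0E] := proj_point vx0 (YZ _ (Z1Y _ (C01 _ Cz0))).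
have -> : z1 = (b / c) *: z0 by rewrite z0E scalerA divfK.
by apply: closed_scale => //; [case: (Ccl 0%N isT)|rewrite mulf_neq0 ?invr_eq0].
Qed.

(** The closures of a point of the image, of the image of the line through u and
    w, and of the whole image form a chain of irreducible closed subsets of Y. If F
    vanished on the second but not on the third, the chain would be strict. *)
Lemma vanish_on_line (u w : 'rV[K]_m.+1) i j (F : {mpoly K[n.+1]}) d :
  (tnth rho i).@[u 0] * (tnth rho j).@[w 0] != (tnth rho j).@[u 0] * (tnth rho i).@[w 0] ->
  F \is d.-homog -> restrict u w (F \mPo rho) = 0 -> F \mPo rho = 0.
Proof.
move=> uw Fd F0; apply/eqP; rewrite -[_ == _]negbK; apply/negP => Frho.
set a := eval_forms rho u; set b := eval_forms rho w.
have a0 : a != 0.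
  by apply: contraNneq uw => /rowP E; have := (E i, E j); rewrite !mxE => -[-> ->]; rewrite !mul0r.
have b0 : b != 0.
  by apply: contraNneq uw => /rowP E; have := (E i, E j); rewrite !mxE => -[-> ->]; rewrite !mulr0.
have line0 : line_pt u w 0 = u by rewrite /line_pt scale0r addr0.
have line1 : line_pt u w 1 = w by rewrite /line_pt scale1r addrC subrK.
pose line s := eval_forms rho (line_pt u w s).
pose C k : pset K n := match k with
  | 0 => zclosure (fun _ : unit => a) | 1 => zclosure line | _ => zclosure (eval_forms rho) end.
case: Ycurve => Ycl [_]; apply; exists C; split.
  case=> [|[|[|//]]] _; split.
  - exact: zclosure_closed.
  - by apply: zclosure_irreducible; [exact: prime_family_point|exists tt].
  - by apply: zclosure_min => // _ _; apply: ratmap_in_curve.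
  - exact: zclosure_closed.
  - apply: zclosure_irreducible; first exact: prime_family_line.
    by exists 0; rewrite /line line0.
  - by apply: zclosure_min => // s; apply: ratmap_in_curve.
  - exact: zclosure_closed.
  - by apply: zclosure_irreducible; [exact: prime_family_forms|exists u].
  - by apply: zclosure_min => // s; apply: ratmap_in_curve.
case=> [|[|//]] _; split.
- apply: zclosure_min; first exact: zclosure_closed.
  move=> _ _; have -> : a = line 0 by rewrite /line line0.
  by apply: zclosure_in; rewrite /line line0.
- move=> sub; have /sub [_ /(_ (minor a i j) 1%N)] : C 1%N b.
    by have -> : b = line 1; [rewrite /line line1|apply: zclosure_in; rewrite /line line1].
  move=> /(_ (minor_homog _ _ _)) H; move: uw; rewrite -subr_eq0.
  have := H (fun _ => _); rewrite !minorE mulrC subrr => /(_ erefl).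
  by rewrite !mxE => ->; rewrite eqxx.
- apply: zclosure_min; first exact: zclosure_closed.
  by move=> s s0; apply: zclosure_in.
- move=> sub; have [t t0] : exists2 t, eval_forms rho t != 0 & F.@[eval_forms rho t 0] != 0.
    apply: prime_family_witness; [exact: prime_family_forms|exact: ratmap_point|].
    have [x xF] := mpoly_nonzero_point Frho; exists x.
    by rewrite meval_eval_forms.
  have [_ /(_ F d Fd) ->] := sub _ (zclosure_in t0); first by rewrite eqxx.
  by move=> s; rewrite meval_eval_forms -horner_restrict F0 horner0.
Qed.

(** A field of functions pulled back from a curve has transcendence degree at
    most 1: this is a relation between A(rho) / B(rho) and A'(rho) / B'(rho). *)
Lemma curve_forms_dependence (A B A' B' : {mpoly K[n.+1]}) d d' :
  A \is d.-homog -> B \is d.-homog -> A' \is d'.-homog -> B' \is d'.-homog ->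
  exists N, exists2 c : 'I_N.+1 * 'I_N.+1 -> K, (exists i, c i != 0) &
    \sum_i c i *: ((A \mPo rho) ^+ i.1 * (B \mPo rho) ^+ (N - i.1) *
                   ((A' \mPo rho) ^+ i.2 * (B' \mPo rho) ^+ (N - i.2))) = 0.
Proof.
move=> Ad Bd A'd B'd; have [u [w [i [j uw]]]] := ratmap_nonconstant.
pose h P := restrict u w (P \mPo rho).
have [N [c c0 cE]] := bimonomial_dependence (h A) (h B) (h A') (h B').
exists N; exists c => //.
pose P := \sum_i c i *: (A ^+ i.1 * B ^+ (N - i.1) * (A' ^+ i.2 * B' ^+ (N - i.2))).
have Phom : P \is (d * N + d' * N).-homog.
  have hom (Q Q' : {mpoly K[n.+1]}) e (a : 'I_N.+1) : Q \is e.-homog -> Q' \is e.-homog ->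
      Q ^+ a * Q' ^+ (N - a) \is (e * N).-homog.
    move=> Qe Q'e; have -> : (e * N = e * a + e * (N - a))%N.
      by rewrite -mulnDr subnKC // -ltnS.
    by apply: dhomogM; apply: dhomogMn.
  by apply: rpred_sum => -[a b] _; apply: rpredZ; apply: dhomogM; apply: hom.
have PE : P \mPo rho = \sum_i c i *: ((A \mPo rho) ^+ i.1 * (B \mPo rho) ^+ (N - i.1) *
                   ((A' \mPo rho) ^+ i.2 * (B' \mPo rho) ^+ (N - i.2))).
  rewrite [LHS]raddf_sum; apply: eq_bigr => k _.
  by rewrite /= comp_mpolyZ !(rmorphM, rmorphXn).
rewrite -PE; apply: (vanish_on_line uw Phom); rewrite PE -[RHS]cE /restrict raddf_sum.
apply: eq_bigr => k _.
by rewrite /= mmapZ !(rmorphM, rmorphXn) /= mul_polyC.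
Qed.

End Curves.

(** * The irrational multiplier *)

Section Irrational.

(** After division by the gcd, x divides y^2 and y divides x^2, so that
    x = y = 1 and t = 2. *)
Lemma square_sum_neq x y t : (0 < y)%N -> (2 < t)%N -> (x ^ 2 + y ^ 2)%N <> (t * x * y)%N.
Proof.
move=> y0 t2 E; have g0 : (0 < gcdn x y)%N by rewrite gcdn_gt0 y0 orbT.
have [x' xE] : exists x', x = (x' * gcdn x y)%N by apply/dvdnP/dvdn_gcdl.
have [y' yE] : exists y', y = (y' * gcdn x y)%N by apply/dvdnP/dvdn_gcdr.
have cop : coprime x' y'.
  by rewrite /coprime -(eqn_pmul2r g0) muln_gcdl -xE -yE mul1n.
have {}E : (x' ^ 2 + y' ^ 2 = t * x' * y')%N.
  move: (gcdn x y) g0 xE yE => h h0 xE yE; have h20 : (0 < h ^ 2)%N by rewrite expn_gt0 h0.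
  apply/eqP; rewrite -(eqn_pmul2r h20) mulnDl -!expnMn -xE -yE E xE yE.
  by apply/eqP; ring.
have x1 : x' = 1%N.
  have dv : (x' %| y' ^ 2)%N.
    by rewrite -(dvdn_addr _ (dvdn_exp (k:=2) isT (dvdnn x'))) E mulnAC dvdn_mull.
  by have /eqP <- := coprimeXr 2 cop; apply/esym/gcdn_idPl.
have y1 : y' = 1%N.
  have dv : (y' %| x' ^ 2)%N.
    by rewrite -(dvdn_addl _ (dvdn_exp (k:=2) isT (dvdnn y'))) E dvdn_mull.
  by move: dv; rewrite x1 exp1n dvdn1 => /eqP.
by move: E; rewrite x1 y1 !muln1; lia.
Qed.

Variables (R : rcfType) (t : nat) (l : R).
Hypothesis t_gt2 : (2 < t)%N.
Hypothesis lE : l ^+ 2 = t%:R * l - 1.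

(** A relation with b <> 0 makes - a / b a root of T^2 - t T + 1, and then
    a^2 + b^2 = t |a| |b|. *)
Lemma irrational_root (a b : int) : a%:~R + b%:~R * l = 0 -> a = 0 /\ b = 0.
Proof.
move=> ab0; have [b0|b0] := eqVneq b 0.
  by move: ab0; rewrite b0 mul0r addr0 => /eqP; rewrite intr_eq0 => /eqP.
have Eint : a ^+ 2 + b ^+ 2 = - (t%:Z * a * b).
  apply: (@intr_inj R); rewrite !expr2 rmorphD rmorphN !rmorphM /= -pmulrn.
  have aE : a%:~R = - (b%:~R * l) by apply/eqP; rewrite -addr_eq0 ab0.
  have -> : a%:~R * a%:~R = b%:~R ^+ 2 * l ^+ 2 :> R by rewrite aE; ring.
  by rewrite aE lE; ring.
exfalso; apply: (@square_sum_neq `|a|%N `|b|%N t) => //; first by rewrite absz_gt0.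
by nia.
Qed.

End Irrational.

Lemma hyperbolic_multiplier (R : rcfType) t : (2 < t)%N ->
  exists2 l : R, 1 < l & l ^+ 2 = t%:R * l - 1.
Proof.
move=> t2; have t3 : 3%:R <= t%:R :> R by rewrite ler_nat.
set s := Num.sqrt (t%:R ^+ 2 - 4%:R) : R.
have s2 : s ^+ 2 = t%:R ^+ 2 - 4%:R by rewrite sqr_sqrtr //; nra.
have s0 : 0 <= s by rewrite sqrtr_ge0.
exists ((t%:R + s) / 2%:R); first by lra.
have -> : ((t%:R + s) / 2%:R) ^+ 2 = (t%:R ^+ 2 + 2%:R * t%:R * s + s ^+ 2) / 4%:R by field.
by rewrite s2; field.
Qed.

(** * The action of mu on weights *)

Section MuWeights.
Variables (K : closedFieldType) (R : rcfType) (p q : nat) (l : R).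
Hypotheses (p_gt0 : (0 < p)%N) (q_gt0 : (0 < q)%N).
Hypothesis l_gt1 : 1 < l.
Hypothesis lE : l ^+ 2 = (p * q - 2)%N%:R * l - 1.
Hypothesis pq_gt4 : (4 < p * q)%N.

(** The third homogeneous coordinate has weight 0: the weights of the affine
    coordinates form the eigenvector (q, 1 + l). *)
Definition mu_weight (i : 'I_3) : R := [:: q%:R; 1 + l; 0]`_i.

Let X : {mpoly K[3]} := 'X_(inord 0).
Let Y : {mpoly K[3]} := 'X_(inord 1).
Let Z : {mpoly K[3]} := 'X_(inord 2).

Let leadX : leadw mu_weight X q%:R.
Proof. by have := leadwXU K mu_weight (inord 0); rewrite /mu_weight inordK. Qed.
Let leadY : leadw mu_weight Y (1 + l).
Proof. by have := leadwXU K mu_weight (inord 1); rewrite /mu_weight inordK. Qed.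
Let leadZ : leadw mu_weight Z 0.
Proof. by have := leadwXU K mu_weight (inord 2); rewrite /mu_weight inordK. Qed.

(** The eigenvector equation. The shift is the weight of the last homogeneous
    coordinate of mu; the dominant terms are Y^q in Z^q + Y^q, as 1 + l > 0, and
    the p-th power of the first coordinate of [mu1], as (1 + l) q > q. *)
Lemma mu_lead i : leadw mu_weight (tnth (mu K p q) i)
  (l * mu_weight i + (q%:R + (1 + l) + q%:R *+ p)).
Proof.
have q0 : 1 <= q%:R :> R by rewrite ler1n.
have lead1 : leadw mu_weight (Z * (Z ^+ q + Y ^+ q)) ((1 + l) *+ q).
  rewrite -[_ *+ q]add0r; apply: leadwM => //; apply: leadw_dominant.
  - by apply: leadwXn leadZ.
  - by apply: leadwXn leadY.
  - by rewrite mul0rn pmulrn_lgt0 // addr_gt0 // (lt_trans ltr01).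
have lead2 : leadw mu_weight (X * Y * Z ^+ q.-1) (q%:R + (1 + l)).
  rewrite -[_ + (1 + l)]addr0 -[X in _ + X](mul0rn _ q.-1).
  by apply: leadwM; [apply: leadwM|apply: leadwXn].
have lead3 : leadw mu_weight (X * Z ^+ q) q%:R.
  by rewrite -[q%:R]addr0 -[X in _ + X](mul0rn _ q); apply: leadwM => //; apply: leadwXn.
have lead_lt : q%:R *+ p < (1 + l) *+ q *+ p.
  by rewrite ltr_pMn2r // -[(1 + l) *+ q]mulr_natr; have := l_gt1; nra.
have pqE : (p * q - 2)%N%:R = p%:R * q%:R - 2%:R :> R.
  by rewrite natrB ?natrM //; lia.
have lE' : l ^+ 2 = (p%:R * q%:R - 2%:R) * l - 1 by rewrite -pqE.
rewrite /mu /comp_forms tnth_mktuple.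
case: i => -[|[|[|//]]] Hi; rewrite [tnth (mu2 _ _) _]/tnth /= ?(rmorphM, rmorphD, rmorphXn) /=
  !comp_mpolyXU !inordK //= /mu_weight /=.
- have -> : l * q%:R + (q%:R + (1 + l) + q%:R *+ p) =
      (1 + l) *+ q + (q%:R + (1 + l)) + q%:R *+ p.-1.
    by case: (p) p_gt0 => // k _ /=; rewrite mulrS; ring.
  by apply: leadwM; [apply: leadwM|apply: leadwXn].
- have -> : l * (1 + l) + (q%:R + (1 + l) + q%:R *+ p) = q%:R + (1 + l) *+ q *+ p.
    rewrite mulrDr mulr1 -expr2 lE'; ring.
  apply: leadwM => //; apply: leadw_dominant lead_lt; exact: leadwXn.
- rewrite mulr0 add0r; apply: leadwM => //; exact: leadwXn.
Qed.

(** Equality of the weights is an integral relation between 1 and l. *)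
Lemma mu_weight_inj (m m' : 'X_{1..3}) :
  mdeg m = mdeg m' -> weight mu_weight m = weight mu_weight m' -> m = m'.
Proof.
have wE k : weight mu_weight k = q%:R *+ k ord0 + (1 + l) *+ k (lift ord0 ord0).
  by rewrite /weight !big_ord_recl big_ord0 /mu_weight /= mul0rn !addr0.
rewrite !wE !mdegE !big_ord_recl !big_ord0 => dE wtE.
set a0 := m ord0 in dE wtE; set b0 := m (lift _ _) in dE wtE.
set a1 := m' ord0 in dE wtE; set b1 := m' (lift ord0 ord0) in dE wtE.
have [] := irrational_root (t := p * q - 2) _ lE
  (a := q%:Z * (a0%:Z - a1%:Z) + (b0%:Z - b1%:Z)) (b := b0%:Z - b1%:Z).
- by lia.
- rewrite rmorphD rmorphM !rmorphB /= -!pmulrn.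
  by move: wtE => /eqP; rewrite -subr_eq0 => /eqP <-; ring.
move=> aE bE; have Eb : b0 = b1 by lia.
have Ea : a0 = a1 by nia.
apply/mnmP => i.
case: (unliftP ord0 i) => [j|] -> //; case: (unliftP ord0 j) => [k|] -> //.
rewrite (ord1 k).
by move: dE; rewrite Ea Eb !addn0 => /addnI/addnI.
Qed.

Lemma homog_leadw (P : {mpoly K[3]}) d :
  P != 0 -> P \is d.-homog -> exists r, leadw mu_weight P r.
Proof.
move=> P0 Pd; have [m Pm] : exists m, lead mu_weight P m.
  apply: lead_exists => // m m' mP m'P; apply: mu_weight_inj.
  by rewrite (dhomog_mf Pd mP) (dhomog_mf Pd m'P).
by exists (weight mu_weight m); exists m.
Qed.

End MuWeights.

(** * Nonexistence of invariant fibrations *)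

Lemma comp_mpoly_homog (K : comNzRingType) k n (F : n.-tuple {mpoly K[k]}) (P : {mpoly K[n]}) d e :
  (forall i, tnth F i \is d.-homog) -> P \is e.-homog -> P \mPo F \is (d * e).-homog.
Proof.
move=> Fd Pe; rewrite comp_mpolyE big_seq; apply: rpred_sum => m mP; apply: rpredZ.
rewrite -(dhomog_mf Pe mP) /= mdegE big_distrr /=.
elim/big_ind2: _ => [|x1 x2 y1 y2|i _]; [exact: dhomog1|exact: dhomogM|exact: dhomogMn].
Qed.

Section InvariantFibration.
Variables (K : closedFieldType) (m n : nat) (f : forms K m m) (Y : pset K n)
  (rho : forms K m n) (g : 'rV[K]_n.+1 -> 'rV[K]_n.+1).
Hypothesis f_ratmap : is_ratmap f.
Hypothesis fib : invariant_fibration f Y rho g.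

(** Near one point of the image, g is given by forms G. The identity says that
    rho o f and G o rho are proportional; it holds at generic points by
    invariance, and hence identically. *)
Lemma fibration_forms : exists G : forms K n n,
  [/\ same_degree G, exists k, tnth G k \mPo rho != 0 &
    forall i j, (tnth rho i \mPo f) * (tnth G j \mPo rho) =
                (tnth rho j \mPo f) * (tnth G i \mPo rho)].
Proof.
case: fib => Ycurve rhoY [_ greg] comm.
have [x0 vx0] := ratmap_point rhoY.
have [G [Gd Gx0 gG]] := greg _ (ratmap_in_curve rhoY vx0).
exists G; split=> //.
  have [k] := rV0Pn _ Gx0; rewrite mxE meval_eval_forms => Gk; exists k.
  by apply: contraNneq Gk => ->; rewrite meval0.
move=> i j; case: f_ratmap => _ [k fk0]; case: (rhoY) => rhorat _ _; have [_ [h rhoh0]] := rhorat.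
have X0 : ('X_ord0 : {mpoly K[m.+1]}) != 0 by rewrite -msupp_eq0 msuppX.
(* Multiplying by these three factors restricts to points x <> 0 where f and rho
   are defined by the given representatives. *)
apply: (mulfI (mulf_neq0 X0 (mulf_neq0 fk0 rhoh0))).
apply/eqP; rewrite -subr_eq0 -mulrBr; apply/eqP/mpoly_fun0 => x.
rewrite mevalM mevalB !mevalM mevalXU.
have [->|x0'] := eqVneq (x 0 ord0) 0; first by rewrite !mul0r.
have [->|fx] := eqVneq (tnth f k).@[x 0] 0; first by rewrite mul0r mulr0 mul0r.
have [->|rx] := eqVneq (tnth rho h).@[x 0] 0; first by rewrite !mulr0 mul0r.
have [rfx|rfx] := eqVneq (eval_forms rho (eval_forms f x)) 0.
  have E a : (tnth rho a \mPo f).@[x 0] = 0.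
    by rewrite -meval_eval_forms; move/rowP/(_ a): rfx; rewrite !mxE.
  by rewrite !E !mul0r subrr mulr0.
have [Gx|Gx] := eqVneq (eval_forms G (eval_forms rho x)) 0.
  have E a : (tnth G a \mPo rho).@[x 0] = 0.
    by rewrite -meval_eval_forms; move/rowP/(_ a): Gx; rewrite !mxE.
  by rewrite !E !mulr0 subrr mulr0.
have xn0 : x != 0 by apply: contraNneq x0' => ->; rewrite mxE.
have fxn0 : eval_forms f x != 0 by apply: contraNneq fx => /rowP/(_ k); rewrite !mxE => ->.
have rxn0 : eval_forms rho x != 0 by apply: contraNneq rx => /rowP/(_ h); rewrite !mxE => ->.
have [c _ cE] := comm x _ _ _ xn0 (ratmap_value f_ratmap fxn0) (ratmap_value rhorat rxn0)
  (ratmap_value rhorat rfx).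
have [b _ bE] := gG _ (ratmap_in_curve rhoY rxn0) Gx.
have E a : (tnth rho a \mPo f).@[x 0] = c * b * (tnth G a \mPo rho).@[x 0].
  rewrite -!meval_eval_forms; move/rowP/(_ a): cE; rewrite bE scalerA.
  by rewrite !mxE.
by rewrite !E; ring.
Qed.

End InvariantFibration.

Section NoFibration.
Variables (K : closedFieldType) (R : rcfType) (p q : nat).
Hypotheses (p_gt0 : (0 < p)%N) (q_gt0 : (0 < q)%N) (pq_gt4 : (4 < p * q)%N).
Variables (n : nat) (Y : pset K n) (rho : forms K 2 n) (g : 'rV[K]_n.+1 -> 'rV[K]_n.+1).
Hypothesis fib : invariant_fibration (mu K p q) Y rho g.
Variable l : R.
Hypothesis l_gt1 : 1 < l.
Hypothesis lE : l ^+ 2 = (p * q - 2)%N%:R * l - 1.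

Local Notation wt := (mu_weight q l).

(** With h the quotient of the two forms, r - s is v(h) and r' - s' below is
    v(h o mu) = l (r - s). If r <> s, the terms of a relation between h and h o mu
    have distinct weights, since an equality between two of these weights is an
    integral relation between 1 and l; so they cannot cancel. *)
Lemma equal_weights i j c r s :
  leadw wt (tnth rho i - c *: tnth rho j) r -> leadw wt (tnth rho j) s -> r = s.
Proof.
move=> Ar Bs; apply/eqP/contraT => rs.
have [G [[e Ge] [k Gk] rhoG]] := fibration_forms (mu_ratmap K p_gt0 q_gt0) fib.
case: fib => Ycurve rhoY _ _; case: (rhoY) => [[[d rhod] _] _ _].
pose A : {mpoly K[n.+1]} := 'X_i - c *: 'X_j.
pose B : {mpoly K[n.+1]} := 'X_j.
have B1 : B \is 1.-homog by rewrite dhomogX /= mdeg1.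
have A1 : A \is 1.-homog by apply: rpredB; [|apply: rpredZ]; rewrite dhomogX /= mdeg1.
pose A' := tnth G i - c *: tnth G j; pose B' := tnth G j.
have A'e : A' \is e.-homog by apply: rpredB => //; apply: rpredZ.
have [N [co co0 coE]] := curve_forms_dependence Ycurve rhoY A1 B1 A'e (Ge j).
have compX h : 'X_h \mPo rho = tnth rho h by rewrite comp_mpolyXU -tnth_nth.
have AE : A \mPo rho = tnth rho i - c *: tnth rho j.
  by rewrite comp_mpolyB comp_mpolyZ !compX.
have BE : B \mPo rho = tnth rho j by apply: compX.
have A'E : A' \mPo rho = (tnth G i \mPo rho) - c *: (tnth G j \mPo rho).
  by rewrite comp_mpolyB comp_mpolyZ.
rewrite AE BE in coE.
have Ad : tnth rho i - c *: tnth rho j \is d.-homog by apply: rpredB => //; apply: rpredZ.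
have l0 : 0 < l by apply: lt_trans l_gt1.
have mul := mu_lead K p_gt0 q_gt0 l_gt1 lE pq_gt4.
have Amu := leadw_comp l0 mul Ad Ar; have Bmu := leadw_comp l0 mul (rhod j) Bs.
have id1 : ((tnth rho i - c *: tnth rho j) \mPo mu K p q) * (B' \mPo rho) =
           (tnth rho j \mPo mu K p q) * (A' \mPo rho).
  rewrite A'E comp_mpolyB comp_mpolyZ mulrBl mulrBr rhoG -scalerAl -scalerAr.
  by rewrite -/B'.
have B'0 : B' \mPo rho != 0.
  have : (tnth rho j \mPo mu K p q) * (tnth G k \mPo rho) != 0.
    by rewrite mulf_neq0 // (leadw_neq0 Bmu).
  by rewrite rhoG mulf_eq0 negb_or => /andP[].
have A'0 : A' \mPo rho != 0.
  have : ((tnth rho i - c *: tnth rho j) \mPo mu K p q) * (B' \mPo rho) != 0.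
    by rewrite mulf_neq0 // (leadw_neq0 Amu).
  by rewrite id1 mulf_eq0 negb_or => /andP[].
have lead_of := homog_leadw p_gt0 q_gt0 l_gt1 lE pq_gt4.
have [r' Ar'] := lead_of _ _ _ A'0 (comp_mpoly_homog rhod A'e).
have [s' Bs'] := lead_of _ _ _ B'0 (comp_mpoly_homog rhod (Ge j)).
have rel : r' - s' = l * (r - s).
  have := leadwM Amu Bs'; rewrite id1 => /(leadw_uniq (leadwM Bmu Ar')).
  by move=> E; lra.
pose f (h : 'I_N.+1 * 'I_N.+1) := r *+ h.1 + s *+ (N - h.1) + (r' *+ h.2 + s' *+ (N - h.2)).
suff /negP[] : \sum_h co h *: ((tnth rho i - c *: tnth rho j) ^+ h.1 * tnth rho j ^+ (N - h.1) *
   ((A' \mPo rho) ^+ h.2 * (B' \mPo rho) ^+ (N - h.2))) != 0 by rewrite coE.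
apply: (leadw_sum_neq0 (w := wt) (r := f)) => // [h|[a b] [a1 b1]].
  by rewrite /f; apply: leadwM; apply: leadwM; apply: leadwXn.
have aN : (a <= N)%N by rewrite -ltnS.
have bN : (b <= N)%N by rewrite -ltnS.
have a1N : (a1 <= N)%N by rewrite -ltnS.
have b1N : (b1 <= N)%N by rewrite -ltnS.
rewrite /f /= !mulrnBr // => E.
have [] := irrational_root (t := p * q - 2) _ lE
  (a := (a : nat)%:Z - (a1 : nat)%:Z) (b := (b : nat)%:Z - (b1 : nat)%:Z).
- by rewrite ltn_subRL.
- apply: (mulfI (_ : r - s != 0)); first by rewrite subr_eq0.
  rewrite mulr0 !rmorphB /= -!pmulrn.
  have r'E : r' = s' + l * (r - s) by rewrite -rel; ring.
  by move/eqP: E; rewrite -subr_eq0 r'E => /eqP <-; ring.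
move=> /eqP; rewrite subr_eq0 => /eqP[Ea] /eqP; rewrite subr_eq0 => /eqP[Eb].
by congr (_, _); apply: val_inj.
Qed.

End NoFibration.

(** If rho_i and rho_j are not proportional, neither are rho_i - c rho_j and
    rho_j, and [equal_weights] applies for every c; but for one c the heaviest
    monomials cancel. The field R only contains the weights. *)
Lemma mu_no_invariant_fibration (K : closedFieldType) (R : rcfType) p q n
    (Y : pset K n) (rho : forms K 2 n) (g : 'rV[K]_n.+1 -> 'rV[K]_n.+1) :
  (0 < p)%N -> (0 < q)%N -> (4 < p * q)%N -> ~ invariant_fibration (mu K p q) Y rho g.
Proof.
move=> p_gt0 q_gt0 pq_gt4 fib.
have [|l l_gt1 lE] := @hyperbolic_multiplier R (p * q - 2); first by lia.
have eq_weights := equal_weights p_gt0 q_gt0 pq_gt4 fib l_gt1 lE.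
case: (fib) => Ycurve rhoY _ _; case: (rhoY) => [[[d rhod] _] _ _].
have [u [w [i [j uw]]]] := ratmap_nonconstant Ycurve rhoY.
have nprop c : tnth rho i - c *: tnth rho j != 0.
  apply: contraNneq uw => /eqP; rewrite subr_eq0 => /eqP ->.
  by rewrite !mevalZ; apply/eqP; ring.
have j0 : tnth rho j != 0.
  by apply: contraNneq uw => ->; rewrite !meval0 mul0r mulr0.
have lead_of := homog_leadw p_gt0 q_gt0 l_gt1 lE pq_gt4.
have [s [mj jm js]] := lead_of _ _ _ j0 (rhod j).
have [r [mi im ir]] := lead_of _ _ _ (nprop 0) (rpredB (rhod i) (rpredZ _ (rhod j))).
have rs : r = s by apply: (eq_weights i j 0); [exists mi|exists mj].
rewrite scale0r subr0 in im.
have mE : mi = mj.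
  apply: (mu_weight_inj p_gt0 q_gt0 l_gt1 lE pq_gt4); last by rewrite ir js.
  by rewrite (dhomog_mf (rhod i) (lead_supp im)) (dhomog_mf (rhod j) (lead_supp jm)).
case: im => ci ci0 iB; case: (jm) => cj cj0 jB; rewrite mE in iB.
have low : below (mu_weight q l) (tnth rho i - (ci / cj) *: tnth rho j) (weight (mu_weight q l) mj).
  have -> : tnth rho i - (ci / cj) *: tnth rho j =
     (tnth rho i - ci *: 'X_[mj]) + (- (ci / cj)) *: (tnth rho j - cj *: 'X_[mj]).
    by rewrite scalerBr scalerA mulNr divfK // !scaleNr; ring.
  by apply: belowD => //; apply: belowZ.
have [r1 ir1] := lead_of _ _ _ (nprop (ci / cj)) (rpredB (rhod i) (rpredZ _ (rhod j))).
have := eq_weights _ _ _ _ _ ir1 (ex_intro2 _ _ mj jm js).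
case: ir1 => m1 /lead_supp/low; rewrite js => lt1 <- E.
by rewrite E ltxx in lt1.
Qed.

Theorem theoremB (R : realType) (p q : nat)
    (hp : (1 <= p)%N) (hq : (1 <= q)%N) (hpq : (4 < p * q)%N) :
  (~ exists (n : nat) (Y : pset R[i] n) (rho : forms R[i] 2 n)
       (g : 'rV[R[i]]_n.+1 -> 'rV[R[i]]_n.+1),
       invariant_fibration (mu R[i] p q) Y rho g) /\
  (~ exists rho : forms R[i] 2 1, conserved_quantity (mu R[i] p q) rho).
Proof.
split=> [[n [Y [rho [g fib]]]]|[rho fib]].
  exact: (mu_no_invariant_fibration R hp hq hpq fib).
exact: (mu_no_invariant_fibration R hp hq hpq fib).
Qed.
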